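(* Minimal projections in $C_6$ are exactly the elements of one of the following three forms: $$\begin{pmatrix} 0 & 0 & 0 \\ 0 & 0 & 0 \\ 0 & 0 & 1 \end{pmatrix};$$ $$\begin{pmatrix} 0 & 0 & 0 \\ 0 & \alpha & a \\ 0 & a^\diamond & \frac1\alpha\|a\|^2 \end{pmatrix},\quad\text{where }\alpha\in\mathbb R\setminus\{0\},\ a\in\mathbb O_R,\ \alpha=\alpha^2+\|a\|^2;$$ $$\begin{pmatrix} \alpha & a & b \\ a^\diamond & \frac1\alpha\|a\|^2 & \frac1\alpha a^\diamond\boxdot b \\ b^\diamond & \frac1\alpha b^\diamond\boxdot a & \frac1\alpha\|b\|^2 \end{pmatrix},\quad\text{where }\alpha\in\mathbb R\setminus\{0\},\ a,b\in\mathbb O_R,\ \alpha=\alpha^2+\|a\|^2+\|b\|^2.$$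
   Context: Cayley–Dickson algebras: $\mathcal A_0=\mathbb C$ with its usual product, $x^{\diamond}=x$, $x^*=\overline{x}$. Inductively $\mathcal A_{n+1}=\mathcal A_n\times\mathcal A_n$ with $\overline{(x_1,x_2)}=(\overline{x_1},\overline{x_2})$, $(x_1,x_2)^{\diamond}=(x_1^{\diamond},-x_2)$, $(x_1,x_2)^*=(x_1^*,-\overline{x_2})$ and $(x_1,x_2)\boxdot(y_1,y_2)=(x_1\boxdot y_1-y_2\boxdot x_2^{\diamond},\ x_1^{\diamond}\boxdot y_2+y_1\boxdot x_2)$. Complex octonions: $\mathbb O=\mathcal A_3$; real octonions: $\mathbb O_R=\{x\in\mathbb O:\overline x=x\}\cong\mathbb R^8$, with $\|\cdot\|$ the Euclidean norm on $\mathbb O_R$. $a\in\mathcal A_n$ is identified with $(a,0)\in\mathcal A_{n+1}$. For matrices over $\mathbb O$: $(x^\diamond)_{ij}=(x_{ji})^\diamond$, $(x^* )_{ij}=(x_{ji})^*$, and $\boxdot$ is the usual matrix product. The Cartan factor of type 6 is the JB$^*$-algebra $C_6=H_3(\mathbb O)=\{x\in M_3(\mathbb O): x^{\diamond}=x\}$ with Jordan product $x\circ y=\frac12(x\boxdot y+y\boxdot x)$ and involution $^*$; its triple product is $\{x,y,z\}=(x\circ y^* )\circ z+(z\circ y^* )\circ x-(x\circ z)\circ y^*$. A projection is $p$ with $p^*=p=p\circ p$; it is minimal if $\{x\in C_6:\{p,p,x\}=x\}=\mathbb Cp\neq\{0\}$. *)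

(* Defs.v *)
From HB Require Import structures.
From mathcomp Require Import all_boot all_order all_algebra.
From mathcomp Require Import complex.
From mathcomp Require Import boolp classical_sets reals.

Set Implicit Arguments.
Unset Strict Implicit.
Unset Printing Implicit Defensive.

Import Order.TTheory GRing.Theory Num.Theory.

Local Open Scope ring_scope.

Reserved Notation "x '\box' y" (at level 40, left associativity).

(* The carrier of the n-th Cayley-Dickson algebra, as a complex vector space;
   dimension 2 ^ n over R[i]. *)
Fixpoint cdalg (R : realType) (n : nat) : lmodType R[i] :=
  match n with
  | 0 => (R[i])^o
  | n'.+1 => (cdalg R n' * cdalg R n')%type
  end.

(* The complex conjugation written with a bar; not the involution *. *)
Fixpoint cdbar (R : realType) (n : nat) : cdalg R n -> cdalg R n :=
  match n with
  | 0 => fun x => conjc x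
  | n'.+1 => fun x => (cdbar x.1, cdbar x.2)
  end.

(* The complex-linear involution written with a diamond. *)
Fixpoint cddia (R : realType) (n : nat) : cdalg R n -> cdalg R n :=
  match n with
  | 0 => fun x => x
  | n'.+1 => fun x => (cddia x.1, - x.2)
  end.

(* The conjugate-linear involution written with a star. *)
Fixpoint cdstar (R : realType) (n : nat) : cdalg R n -> cdalg R n :=
  match n with
  | 0 => fun x => conjc x
  | n'.+1 => fun x => (cdstar x.1, - cdbar x.2)
  end.

Fixpoint cdmul (R : realType) (n : nat) :
    cdalg R n -> cdalg R n -> cdalg R n :=
  match n with
  | 0 => fun x y => (x : R[i]) * y
  | n'.+1 => fun x y =>
      (cdmul x.1 y.1 - cdmul y.2 (cddia x.2),
       cdmul (cddia x.1) y.2 + cdmul y.1 x.2)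
  end.

Notation "x '\box' y" := (cdmul x y) : ring_scope.

(* The inclusion of the complex numbers obtained by iterating the
   identification of a with (a, 0). *)
Fixpoint cdinj (R : realType) (n : nat) (c : R[i]) {struct n} : cdalg R n :=
  match n return cdalg R n with
  | 0 => c
  | n'.+1 => (cdinj n' c, 0)
  end.

(* The sum of the squared moduli of the 2 ^ n complex coordinates; if x is
   fixed by cdbar these coordinates are real. *)
Fixpoint cdnorm2 (R : realType) (n : nat) : cdalg R n -> R :=
  match n with
  | 0 => fun x => complex.Re x ^+ 2 + complex.Im x ^+ 2
  | n'.+1 => fun x => cdnorm2 x.1 + cdnorm2 x.2
  end.

Definition cdnorm (R : realType) (n : nat) (x : cdalg R n) : R :=
  Num.sqrt (cdnorm2 x).

Definition octonion (R : realType) : lmodType R[i] := cdalg R 3.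

Definition octR (R : realType) : set (octonion R) :=
  [set x | cdbar x = x]%classic.

Definition octonion_of_real (R : realType) (r : R) : octonion R :=
  cdinj 3 (real_complex R r).

Definition mxdia (R : realType) (x : 'M[octonion R]_3) : 'M[octonion R]_3 :=
  \matrix_(i, j) cddia (x j i).

Definition mxstar (R : realType) (x : 'M[octonion R]_3) : 'M[octonion R]_3 :=
  \matrix_(i, j) cdstar (x j i).

(* The library's *m needs entries in an associative ring. *)
Definition mxbox (R : realType) (x y : 'M[octonion R]_3) : 'M[octonion R]_3 :=
  \matrix_(i, j) \sum_(k < 3) x i k \box y k j.

(* Likewise, the library's scaling needs scalars in the ring of entries. *)
Definition mxscale (R : realType) (c : R[i]) (x : 'M[octonion R]_3) :
    'M[octonion R]_3 :=
  \matrix_(i, j) (c *: x i j).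

Definition C6 (R : realType) : set 'M[octonion R]_3 :=
  [set x | mxdia x = x]%classic.

Definition jordan (R : realType) (x y : 'M[octonion R]_3) :
    'M[octonion R]_3 :=
  mxscale 2^-1 (mxbox x y + mxbox y x).

Definition triple (R : realType) (x y z : 'M[octonion R]_3) :
    'M[octonion R]_3 :=
  jordan (jordan x (mxstar y)) z + jordan (jordan z (mxstar y)) x
  - jordan (jordan x z) (mxstar y).

Definition projection (R : realType) (p : 'M[octonion R]_3) : Prop :=
  [/\ C6 p, mxstar p = p & p = jordan p p].

Definition complex_span (R : realType) (p : 'M[octonion R]_3) :
    set 'M[octonion R]_3 :=
  [set mxscale c p | c in [set: R[i]]]%classic.

Definition minimal_projection (R : realType) (p : 'M[octonion R]_3) : Prop :=
  [/\ projection p,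
      [set x | C6 x /\ triple p p x = x]%classic = complex_span p &
      complex_span p <> [set 0]%classic].

Definition mx33 (T : Type) (a00 a01 a02 a10 a11 a12 a20 a21 a22 : T) :
    'M[T]_3 :=
  \matrix_(i < 3, j < 3)
    nth a00 [:: a00; a01; a02; a10; a11; a12; a20; a21; a22] (3 * i + j)%N.

(* Main.v *)
(** [{p, p, x} = p o x] for a projection [p], so [p] is minimal iff [p <> 0] and
    the fixed points of [x |-> p o x] are the multiples of [p].

    If [p] is minimal then [U_p e1], the first column of [p] times its first
    row, is such a fixed point, hence a multiple of [p]. When the entry [p11]
    is nonzero this reads off the third form. When [p11 = 0] the equation
    [p o p = p] kills the first row, and the same argument applies to [p22],
    then to [p33].

    Conversely, if [p] has the third form and [p o x = x], subtract a multiple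
    of [p] so that [x11 = 0]. In the remaining linear system, the alternative
    laws of the octonions force [x12] and [x13] to be scalar multiples of [p12]
    and [p13]; what is left is a system of scalar equations with only the zero
    solution. The other two forms are cyclic shifts of the third one. *)
Require Import Defs.
From mathcomp Require Import all_boot all_order all_algebra.
From mathcomp Require Import complex ring.
From mathcomp Require Import boolp classical_sets reals.

Set Implicit Arguments.
Unset Strict Implicit.
Unset Printing Implicit Defensive.

Import Order.TTheory GRing.Theory Num.Theory.
Local Open Scope ring_scope.

(** Linear arithmetic by hand: a goal is reduced by [c] times a known equation, and [ring] closes
    the rest. Successive uses give a linear combination of hypotheses. *)
Lemma addr_lincomb (R : realType) (c u v x y : R[i]) :
  u = v -> x + c * v = y + c * u -> x = y.
Proof. by move=> -> /addIr. Qed.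
Arguments addr_lincomb {R} c {u v x y}.

(** The complex-bilinear form polarizing the norm [N(x) = cdform x x]. It is not Hermitian, so it
    has isotropic vectors; it is anisotropic only on elements fixed by [cdbar]. *)
Fixpoint cdform (R : realType) (n : nat) : cdalg R n -> cdalg R n -> R[i] :=
  match n with
  | 0 => fun x y => (x : R[i]) * y
  | n'.+1 => fun x y => cdform x.1 y.1 + cdform x.2 y.2
  end.

Arguments cdform {R n} x y.

(** * Linearity of the Cayley-Dickson operations *)

Lemma cddiaK (R : realType) n : involutive (@cddia R n).
Proof. by elim: n => //= n IH [x y] /=; rewrite IH opprK. Qed.

Lemma cddiaD (R : realType) n (x y : cdalg R n) :
  cddia (x + y) = cddia x + cddia y.
Proof.
elim: n x y => //= n IH [x x'] [y y'] /=.
by congr pair; rewrite /= ?IH ?opprD.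
Qed.

Lemma cddiaZ (R : realType) n (c : R[i]) (x : cdalg R n) :
  cddia (c *: x) = c *: cddia x.
Proof.
elim: n x => //= n IH [x x'] /=.
by congr pair; rewrite /= ?IH ?scalerN.
Qed.

Lemma cddiaN (R : realType) n (x : cdalg R n) : cddia (- x) = - cddia x.
Proof. by rewrite -scaleN1r cddiaZ scaleN1r. Qed.

Lemma cddia0 (R : realType) n : cddia (0 : cdalg R n) = 0.
Proof. by rewrite -[X in cddia X](scale0r 0) cddiaZ scale0r. Qed.

Lemma cdbarN (R : realType) n (x : cdalg R n) : cdbar (- x) = - cdbar x.
Proof.
elim: n x => [x|n IH [x x']] /=; first exact: rmorphN.
by congr pair; rewrite /= IH.
Qed.

(** Both sides are proved in one induction because the doubled product swaps its factors, so
    linearity on one side at level [n.+1] uses both at level [n]. *)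
Lemma cdmulDZ (R : realType) n :
  (forall (c : R[i]) (x y z : cdalg R n),
    (c *: x + y) \box z = c *: (x \box z) + y \box z) /\
  (forall (c : R[i]) (x y z : cdalg R n),
    z \box (c *: x + y) = c *: (z \box x) + z \box y).
Proof.
elim: n => [|n [IHl IHr]].
  by split=> c x y z; rewrite /= /GRing.scale /=; ring.
split=> c [x x'] [y y'] [z z'] /=; congr pair;
  rewrite /= ?(cddiaD, cddiaZ) ?(IHl, IHr) ?scalerBr ?scalerDr ?opprD -!addrA;
  by congr (_ + _); rewrite addrCA.
Qed.

Lemma cdmul0l (R : realType) n (x : cdalg R n) : 0 \box x = 0.
Proof.
have := (cdmulDZ R n).1 1 0 0 x.
rewrite !scale1r addr0 => /eqP.
by rewrite -subr_eq0 opprD addNKr oppr_eq0 => /eqP.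
Qed.

Lemma cdmul0r (R : realType) n (x : cdalg R n) : x \box 0 = 0.
Proof.
have := (cdmulDZ R n).2 1 0 0 x.
rewrite !scale1r addr0 => /eqP.
by rewrite -subr_eq0 opprD addNKr oppr_eq0 => /eqP.
Qed.

Lemma cdmulDl (R : realType) n (x y z : cdalg R n) :
  (x + y) \box z = x \box z + y \box z.
Proof. by have := (cdmulDZ R n).1 1 x y z; rewrite !scale1r. Qed.

Lemma cdmulDr (R : realType) n (x y z : cdalg R n) :
  z \box (x + y) = z \box x + z \box y.
Proof. by have := (cdmulDZ R n).2 1 x y z; rewrite !scale1r. Qed.

Lemma cdmulZl (R : realType) n c (x z : cdalg R n) :
  (c *: x) \box z = c *: (x \box z).
Proof. by have := (cdmulDZ R n).1 c x 0 z; rewrite cdmul0l !addr0. Qed.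

Lemma cdmulZr (R : realType) n c (x z : cdalg R n) :
  z \box (c *: x) = c *: (z \box x).
Proof. by have := (cdmulDZ R n).2 c x 0 z; rewrite cdmul0r !addr0. Qed.

Lemma cdmulNl (R : realType) n (x z : cdalg R n) : (- x) \box z = - (x \box z).
Proof. by rewrite -scaleN1r cdmulZl scaleN1r. Qed.

Lemma cdmulNr (R : realType) n (x z : cdalg R n) : z \box (- x) = - (z \box x).
Proof. by rewrite -scaleN1r cdmulZr scaleN1r. Qed.

Lemma cddiaM (R : realType) n (x y : cdalg R n) :
  cddia (x \box y) = cddia y \box cddia x.
Proof.
elim: n x y => [x y|n IH [x x'] [y y']] /=; first exact: mulrC.
congr pair; rewrite /= ?(cddiaD, cddiaN, IH, cddiaK, cdmulNl, cdmulNr) ?opprK //.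
by rewrite opprD addrC.
Qed.

(** * The bilinear form and its adjunction with the product *)

Lemma cdformC (R : realType) n (x y : cdalg R n) : cdform x y = cdform y x.
Proof.
by elim: n x y => [x y|n IH [x x'] [y y']] /=; [exact: mulrC|congr +%R].
Qed.

Lemma cdformDl (R : realType) n (x y z : cdalg R n) :
  cdform (x + y) z = cdform x z + cdform y z.
Proof.
elim: n x y z => [x y z|n IH [x x'] [y y'] [z z']] /=; first exact: mulrDl.
by rewrite !IH addrACA.
Qed.

Lemma cdformZl (R : realType) n c (x z : cdalg R n) :
  cdform (c *: x) z = c * cdform x z.
Proof.
elim: n x z => [x z|n IH [x x'] [z z']] /=; first by rewrite mulrA.
by rewrite !IH mulrDr.
Qed.

Lemma cdformDr (R : realType) n (x y z : cdalg R n) :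
  cdform z (x + y) = cdform z x + cdform z y.
Proof. by rewrite cdformC cdformDl !(cdformC z). Qed.

Lemma cdformZr (R : realType) n c (x z : cdalg R n) :
  cdform z (c *: x) = c * cdform z x.
Proof. by rewrite cdformC cdformZl (cdformC z). Qed.

Lemma cdformNl (R : realType) n (x z : cdalg R n) : cdform (- x) z = - cdform x z.
Proof. by rewrite -scaleN1r cdformZl mulN1r. Qed.

Lemma cdformNr (R : realType) n (x z : cdalg R n) : cdform z (- x) = - cdform z x.
Proof. by rewrite cdformC cdformNl cdformC. Qed.

Lemma cdform0l (R : realType) n (x : cdalg R n) : cdform 0 x = 0.
Proof. by rewrite -(scale0r 0) cdformZl mul0r. Qed.

Lemma cdform0r (R : realType) n (x : cdalg R n) : cdform x 0 = 0.
Proof. by rewrite cdformC cdform0l. Qed.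

(** Nondegeneracy. Throughout, pairing with an arbitrary [v] turns an equation between vectors into
    a scalar one within reach of [ring]. *)
Lemma cdform_inj (R : realType) n (x y : cdalg R n) :
  cdform x =1 cdform y -> x = y.
Proof.
elim: n x y => [x y /(_ 1)|n IH [x x'] [y y'] e] /=; first by rewrite /= !mulr1.
congr pair; apply: IH => z.
  by have := e (z, 0); rewrite /= !cdform0r !addr0.
by have := e (0, z); rewrite /= !cdform0r !add0r.
Qed.

Lemma cdform_dia (R : realType) n (x y : cdalg R n) :
  cdform (cddia x) (cddia y) = cdform x y.
Proof.
by elim: n x y => //= n IH [x x'] [y y'] /=; rewrite IH cdformNl cdformNr opprK.
Qed.

(** The adjoint of left multiplication by [x] is left multiplication by [cddia x]; this holds at
    every level, alternative or not. *)
Lemma cdform_mull (R : realType) n (x y z : cdalg R n) :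
  cdform (x \box y) z = cdform y (cddia x \box z).
Proof.
elim: n x y z => [x y z|n IH [x x'] [y y'] [z z']] /=; first by rewrite mulrCA mulrA.
(* The adjunction for right multiplication follows by applying the anti-automorphism [cddia], which
   preserves the form. *)
have IHr (u v w : cdalg R n) : cdform (u \box v) w = cdform u (w \box cddia v).
  by rewrite -cdform_dia cddiaM IH cddiaK -cdform_dia cddiaM !cddiaK.
rewrite !(cdformDl, cdformDr, cdformNl, cdformNr) cddiaN !cdmulNr !cdformNr opprK.
by rewrite (IH x y) (IHr y' (cddia x')) (IH (cddia x) y') (IHr y x') !cddiaK; ring.
Qed.

(** * Scalars inside the algebras, and the norm of real elements *)

Lemma cdinj_eq0 (R : realType) n (c : R[i]) : (cdinj n c == 0) = (c == 0).
Proof. by elim: n => //= n IH; rewrite -pair_eqE /= IH eqxx andbT. Qed.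

Lemma cdinjD (R : realType) n (c d : R[i]) :
  cdinj n (c + d) = cdinj n c + cdinj n d.
Proof. by elim: n => //= n IH; congr pair; rewrite /= ?IH ?addr0. Qed.

Lemma cdinjZ (R : realType) n (c d : R[i]) : cdinj n (c * d) = c *: cdinj n d.
Proof. by elim: n => //= n IH; congr pair; rewrite /= ?IH ?scaler0. Qed.

Lemma cddia_inj (R : realType) n (c : R[i]) : cddia (cdinj n c) = cdinj n c.
Proof. by elim: n => //= n ->; rewrite oppr0. Qed.

Lemma cdbar_inj (R : realType) n (c : R[i]) :
  cdbar (cdinj n c) = cdinj n (conjc c).
Proof.
elim: n => //= n ->; congr pair.
have := cdbarN (0 : cdalg R n); rewrite oppr0 => /eqP.
rewrite -subr_eq0 opprK -mulr2n -scaler_nat scaler_eq0 pnatr_eq0 /=.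
by move/eqP.
Qed.

(** This makes the diagonal entries of elements of [C6] scalars. *)
Lemma cddia_fixed (R : realType) n (x : cdalg R n) :
  cddia x = x -> exists c, x = cdinj n c.
Proof.
elim: n x => [x _|n IH [x x'] /= [/IH[c ->] /eqP]]; first by exists x.
rewrite eq_sym -subr_eq0 opprK -mulr2n -scaler_nat scaler_eq0 pnatr_eq0 /=.
by move/eqP->; exists c.
Qed.

Lemma cdmul_injl (R : realType) n c (x : cdalg R n) : cdinj n c \box x = c *: x.
Proof.
elim: n x => //= n IH [x x'] /=.
by congr pair; rewrite /= ?cddia_inj ?cddia0 ?IH ?cdmul0r ?subr0 ?addr0.
Qed.

Lemma cdmul_injr (R : realType) n c (x : cdalg R n) : x \box cdinj n c = c *: x.
Proof. by rewrite -[LHS]cddiaK cddiaM cddia_inj cdmul_injl cddiaZ cddiaK. Qed.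

(** Polarized form of [x x^dia = N(x)]. *)
Lemma cdmul_dia_sym (R : realType) n (x y : cdalg R n) :
  x \box cddia y + y \box cddia x = cdinj n (2 * cdform x y).
Proof.
elim: n x y => [x y|n IH [x x'] [y y']] /=; first by ring.
congr pair => /=.
  by rewrite mulrDr cdinjD -!IH !cdmulNl !opprK addrACA [y' \box _ + _]addrC.
by rewrite !cdmulNr addrACA -opprD [X in _ + X]addrC addNr.
Qed.

Lemma cdstarE (R : realType) n (x : cdalg R n) : cdstar x = cdbar (cddia x).
Proof. by elim: n x => //= n IH [x x'] /=; rewrite IH cdbarN. Qed.

Lemma cdnorm2_ge0 (R : realType) n (x : cdalg R n) : 0 <= cdnorm2 x.
Proof.
by elim: n x => [x|n IH [x x']] /=; rewrite addr_ge0 // sqr_ge0.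
Qed.

Lemma cdnorm2_eq0 (R : realType) n (x : cdalg R n) : cdnorm2 x = 0 -> x = 0.
Proof.
elim: n x => [[x y]|n IH [x x']] /= /eqP.
  by rewrite paddr_eq0 ?sqr_ge0 // !sqrf_eq0 => /andP[/eqP-> /eqP->].
by rewrite paddr_eq0 ?cdnorm2_ge0 // => /andP[/eqP/IH-> /eqP/IH->].
Qed.

Lemma sqr_cdnorm (R : realType) n (x : cdalg R n) : cdnorm x ^+ 2 = cdnorm2 x.
Proof. by rewrite sqr_sqrtr // cdnorm2_ge0. Qed.

Lemma cdform_real (R : realType) n (x : cdalg R n) :
  cdbar x = x -> cdform x x = real_complex R (cdnorm2 x).
Proof.
elim: n x => [[x y]|n IH [x x']] /=.
  move=> [] /eqP; rewrite eq_sym -subr_eq0 opprK -mulr2n mulrn_eq0 => /eqP->.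
  by simpc; congr (_ +i* _)%C; ring.
by case=> /IH-> /IH->; rewrite rmorphD.
Qed.

(** * Alternative laws and their consequences *)

Definition cd_alternative (R : realType) (n : nat) : Prop :=
  forall x y : cdalg R n, cddia x \box (x \box y) = cdform x x *: y.

(** The only computation in the eight coordinates. Everything later takes this law as a hypothesis
    on a general [n], so octonions stay folded. *)
Lemma oct_alternative (R : realType) : cd_alternative R 3.
Proof.
move=> [[[x0 x1] [x2 x3]] [[x4 x5] [x6 x7]]] [[[y0 y1] [y2 y3]] [[y4 y5] [y6 y7]]].
rewrite /=; repeat congr pair; rewrite /= /GRing.scale /=; ring.
Qed.

Lemma cd_mulKr (R : realType) n (x y : cdalg R n) : cd_alternative R n ->
  (y \box x) \box cddia x = cdform x x *: y.
Proof.
move=> alt; apply: (can_inj (@cddiaK R n)).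
by have := alt (cddia x) (cddia y); rewrite !cddiaM cddiaZ cddiaK cdform_dia.
Qed.

(** The left alternative law polarized in its repeated variable. *)
Lemma cd_mul_sym (R : realType) n (x y z : cdalg R n) : cd_alternative R n ->
  cddia x \box (y \box z) + cddia y \box (x \box z) = (2 * cdform x y) *: z.
Proof.
move=> alt; have := alt (x + y) z.
rewrite cddiaD !cdmulDl !cdmulDr !alt => H; apply: cdform_inj => v.
have := congr1 (cdform^~ v) H.
rewrite !(cdformDl, cdformDr, cdformZl) (cdformC y x) => e.
by apply: (addr_lincomb 1 e); ring.
Qed.

Lemma cd_form_mul (R : realType) n (x y : cdalg R n) : cd_alternative R n ->
  cdform (x \box y) (x \box y) = cdform x x * cdform y y.
Proof. by move=> alt; rewrite cdform_mull alt cdformZr. Qed.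

(** * The Jordan product in coordinates *)

(* [HCoord d1 d2 d3 u1 u2 u3] stands for the matrix with rows
   (d1, u3, u2^dia), (u3^dia, d2, u1), (u2, u1^dia, d3): the indices are placed so
   that the cyclic shift [hrot] is a conjugation by a permutation matrix. *)
Record hcoord (R : realType) (n : nat) := HCoord {
  hd1 : R[i]; hd2 : R[i]; hd3 : R[i];
  hu1 : cdalg R n; hu2 : cdalg R n; hu3 : cdalg R n }.

Definition hrot (R : realType) (n : nat) (p : hcoord R n) : hcoord R n :=
  HCoord (hd2 p) (hd3 p) (hd1 p) (hu2 p) (hu3 p) (hu1 p).

(** Conjugation by the transposition of the last two indices; the off-diagonal entries cross the
    diagonal, hence the [cddia]. *)
Definition hflip (R : realType) (n : nat) (p : hcoord R n) : hcoord R n :=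
  HCoord (hd1 p) (hd3 p) (hd2 p) (cddia (hu1 p)) (cddia (hu3 p)) (cddia (hu2 p)).

Definition hscale (R : realType) (n : nat) (c : R[i]) (p : hcoord R n) : hcoord R n :=
  HCoord (c * hd1 p) (c * hd2 p) (c * hd3 p)
         (c *: hu1 p) (c *: hu2 p) (c *: hu3 p).

Definition hsub (R : realType) (n : nat) (p q : hcoord R n) : hcoord R n :=
  HCoord (hd1 p - hd1 q) (hd2 p - hd2 q) (hd3 p - hd3 q)
         (hu1 p - hu1 q) (hu2 p - hu2 q) (hu3 p - hu3 q).

(** By cyclic symmetry one diagonal formula, [jdiag], and one off-diagonal formula, [joff], describe
    the whole Jordan product; [jordan_hmx] identifies [jmul] with [jordan]. *)
Definition jdiag (R : realType) (n : nat) (d e : R[i]) (a x b y : cdalg R n) : R[i] :=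
  d * e + cdform a x + cdform b y.

Definition joff (R : realType) (n : nat) (d2 d3 e2 e3 : R[i])
    (a1 a2 a3 x1 x2 x3 : cdalg R n) : cdalg R n :=
  2^-1 *: ((d2 + d3) *: x1 + (e2 + e3) *: a1
           + cddia (a2 \box x3 + x2 \box a3)).

Definition jmul (R : realType) (n : nat) (p q : hcoord R n) : hcoord R n :=
  let: HCoord d1 d2 d3 a1 a2 a3 := p in
  let: HCoord e1 e2 e3 x1 x2 x3 := q in
  HCoord (jdiag d1 e1 a2 x2 a3 x3) (jdiag d2 e2 a3 x3 a1 x1)
         (jdiag d3 e3 a1 x1 a2 x2)
         (joff d2 d3 e2 e3 a1 a2 a3 x1 x2 x3)
         (joff d3 d1 e3 e1 a2 a3 a1 x2 x3 x1)
         (joff d1 d2 e1 e2 a3 a1 a2 x3 x1 x2).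

Lemma jmul_rot (R : realType) (n : nat) (p q : hcoord R n) :
  jmul (hrot p) (hrot q) = hrot (jmul p q).
Proof. by case: p q => [? ? ? ? ? ?] [? ? ? ? ? ?]. Qed.

Lemma joff_flip (R : realType) (n : nat) (d2 d3 e2 e3 : R[i]) (a1 a2 a3 x1 x2 x3 : cdalg R n) :
  joff d3 d2 e3 e2 (cddia a1) (cddia a3) (cddia a2) (cddia x1) (cddia x3) (cddia x2) =
  cddia (joff d2 d3 e2 e3 a1 a2 a3 x1 x2 x3).
Proof.
rewrite /joff !(cddiaZ, cddiaD, cddiaM, cddiaK) [d3 + _]addrC [e3 + _]addrC.
by congr (_ *: (_ + _)); rewrite addrC.
Qed.

Lemma jmul_linear (R : realType) (n : nat) (c : R[i]) (p q r : hcoord R n) :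
  jmul p (hsub q (hscale c r)) = hsub (jmul p q) (hscale c (jmul p r)).
Proof.
case: p q r => [d1 d2 d3 a1 a2 a3] [e1 e2 e3 x1 x2 x3] [f1 f2 f3 y1 y2 y3].
rewrite /hsub /hscale /= /jdiag /joff.
congr HCoord; rewrite ?(cdformDr, cdformNr, cdformZr); try ring;
  apply: cdform_inj => v;
  rewrite !(cddiaD, cdmulDl, cdmulDr, cdmulNl, cdmulNr, cdmulZl, cdmulZr, cddiaN, cddiaZ);
  rewrite !(cdformDl, cdformNl, cdformZl) ?(cdformDl, cdformNl, cdformZl); ring.
Qed.

Lemma jmul_scale (R : realType) (n : nat) (c : R[i]) (p q : hcoord R n) :
  jmul p (hscale c q) = hscale c (jmul p q).
Proof.
case: p q => [d1 d2 d3 a1 a2 a3] [e1 e2 e3 x1 x2 x3].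
rewrite /hscale /= /jdiag /joff.
congr HCoord; rewrite ?cdformZr; try ring;
  apply: cdform_inj => v;
  rewrite !(cddiaD, cdmulZl, cdmulZr, cddiaZ) !(cdformDl, cdformZl); ring.
Qed.

Lemma joff_fixedP (R : realType) (n : nat) (d2 d3 e2 e3 : R[i])
    (a1 a2 a3 x1 x2 x3 w : cdalg R n) :
  joff d2 d3 e2 e3 a1 a2 a3 x1 x2 x3 = w <->
  (d2 + d3) *: x1 + (e2 + e3) *: a1 + cddia (a2 \box x3 + x2 \box a3) = 2 *: w.
Proof.
split=> [<-|H]; first by rewrite scalerA divff ?scale1r // pnatr_eq0.
by rewrite /joff H scalerA mulVf ?scale1r // pnatr_eq0.
Qed.

(** * The corner of an idempotent is a fixed point *)

(* [hcorner p] is [U_p e1], the first column of [p] times its first row. *)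
Definition hcorner (R : realType) (n : nat) (p : hcoord R n) : hcoord R n :=
  HCoord (hd1 p ^+ 2) (cdform (hu3 p) (hu3 p)) (cdform (hu2 p) (hu2 p))
         (cddia (hu2 p \box hu3 p)) (hd1 p *: hu2 p) (hd1 p *: hu3 p).

Lemma cd_mulVKl (R : realType) n (x y : cdalg R n) : cd_alternative R n ->
  x \box (cddia x \box y) = cdform x x *: y.
Proof. by move=> alt; have := alt (cddia x) y; rewrite cddiaK cdform_dia. Qed.

Lemma cd_mulVKr (R : realType) n (x y : cdalg R n) : cd_alternative R n ->
  (y \box cddia x) \box x = cdform x x *: y.
Proof. by move=> /(cd_mulKr (cddia x) y); rewrite cddiaK cdform_dia. Qed.

(** Both sides are the scalar part of a triple product, which is invariant under cyclic permutation
    of the factors. *)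
Lemma cdform_cyc (R : realType) n (x y z : cdalg R n) :
  cdform x (cddia (y \box z)) = cdform z (cddia (x \box y)).
Proof.
by rewrite -[LHS]cdform_dia cddiaK cdformC cdform_mull cddiaM.
Qed.

Lemma joff_idemP (R : realType) n (d2 d3 : R[i]) (a1 a2 a3 : cdalg R n) :
  joff d2 d3 d2 d3 a1 a2 a3 a1 a2 a3 = a1 ->
  cddia (a2 \box a3) = (1 - d2 - d3) *: a1.
Proof.
move/joff_fixedP => H; apply: cdform_inj => v.
have := congr1 (cdform^~ v) H.
rewrite !(cddiaD, cdformDl, cdformZl) => e.
have c2 : 2 != 0 :> R[i] by rewrite pnatr_eq0.
apply: (mulfI c2); apply: (addr_lincomb 1 e); ring.
Qed.

(** Idempotence makes a product such as [a1 a2] a multiple of the conjugate of the third entry;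
    alternativity then collapses the triple products in the corner. *)
Lemma hcorner_fixed (R : realType) n (p : hcoord R n) :
  cd_alternative R n -> jmul p p = p -> jmul p (hcorner p) = hcorner p.
Proof.
move=> alt; case: p => [d1 d2 d3 a1 a2 a3] [e1 e2 e3].
move=> /joff_idemP f1 /joff_idemP f2 /joff_idemP f3.
(* Alternativity writes [N(a2) a1] as [(a1 a2) a2^dia], and [f3] makes [a1 a2] a multiple of
   [a3^dia]. *)
have N2a1 : cdform a2 a2 *: a1 = (1 - d1 - d2) *: cddia (a2 \box a3).
  rewrite -(cd_mulKr a2 a1 alt) -[a1 \box a2]cddiaK f3 cddiaZ cdmulZl.
  by rewrite cddiaM.
have N3a1 : cdform a3 a3 *: a1 = (1 - d3 - d1) *: cddia (a2 \box a3).
  by rewrite -(alt a3 a1) -[a3 \box a1]cddiaK f2 cddiaZ cdmulZr cddiaM.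
rewrite /hcorner /=; congr HCoord.
- by move: e1; rewrite /jdiag !cdformZr => e1; apply: (addr_lincomb d1 e1);
    ring.
- have := congr1 (cdform a3) f3; rewrite -cdform_cyc cdformZr /jdiag => ->.
  by rewrite cdformZr; ring.
- have := congr1 (cdform a2) f2; rewrite cdform_cyc cdformZr /jdiag => ->.
  by rewrite cdformZr; ring.
- apply/joff_fixedP; rewrite cdmulZr cdmulZl !(cddiaD, cddiaZ).
  apply: cdform_inj => v.
  have n2 := congr1 (cdform^~ v) N2a1; have n3 := congr1 (cdform^~ v) N3a1.
  move: n2 n3; rewrite /= !(cdformDl, cdformZl) => n2 n3.
  by apply: (addr_lincomb 1 n2); apply: (addr_lincomb 1 n3); ring.
- apply/joff_fixedP; rewrite cdmulZl (cddiaM a2 a3) cd_mulVKl // !(cddiaD, cddiaZ) f2 cddiaK.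
  apply: cdform_inj => v; rewrite !(cdformDl, cdformZl).
  by move: e1; rewrite /jdiag => e1; apply: (addr_lincomb (cdform a2 v) e1);
    ring.
- apply/joff_fixedP; rewrite cdmulZr (cddiaM a2 a3) cd_mulVKr // !(cddiaD, cddiaZ) f3 cddiaK.
  apply: cdform_inj => v; rewrite !(cdformDl, cdformZl).
  by move: e1; rewrite /jdiag => e1; apply: (addr_lincomb (cdform a3 v) e1);
    ring.
Qed.

(** * Rank-one elements and their fixed points *)

(* [p = al^-1 v v^dia] has trace [1], where [v] is the first column of [p] and
   [al] its top entry. *)
Definition rank1 (R : realType) n (p : hcoord R n) : Prop :=
  let: HCoord al be ga a1 a2 a3 := p in
  [/\ cdform a3 a3 = al * be, cdform a2 a2 = al * ga,
      al *: a1 = cddia (a2 \box a3) & al + be + ga = 1].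

(** Together with [rank1] this says that the Freudenthal adjoint of [p] vanishes. Each relation is
    multiplied by [al], so that [al a1] becomes [(a2 a3)^dia] and alternativity applies. *)
Lemma rank1_mul (R : realType) n (al be ga : R[i]) (a1 a2 a3 : cdalg R n) :
  cd_alternative R n -> al != 0 -> rank1 (HCoord al be ga a1 a2 a3) ->
  [/\ cdform a1 a1 = be * ga, cddia (a3 \box a1) = be *: a2
    & cddia (a1 \box a2) = ga *: a3].
Proof.
move=> alt al0 [N3 N2 Ha1 _]; split.
- apply: (mulfI al0); apply: (mulfI al0).
  rewrite -cdformZl -cdformZr Ha1 cdform_dia cd_form_mul // N2 N3; ring.
- apply: (scalerI al0); rewrite -cddiaZ -cdmulZr Ha1 (cddiaM a2 a3) cd_mulVKl //.
  by rewrite cddiaZ cddiaK N3 scalerA.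
- apply: (scalerI al0); rewrite -cddiaZ -cdmulZl Ha1 (cddiaM a2 a3) cd_mulVKr //.
  by rewrite cddiaZ cddiaK N2 scalerA.
Qed.

(** A vanishing adjoint gives [p o p = tr(p) p], and the trace is one. *)
Lemma rank1_idem (R : realType) n (p : hcoord R n) :
  cd_alternative R n -> hd1 p != 0 -> rank1 p -> jmul p p = p.
Proof.
move=> alt; case: p => [al be ga a1 a2 a3] /= al0 r1.
have [N1 f2 f3] := rank1_mul alt al0 r1.
case: r1 => N3 N2 Ha1 tr.
rewrite /jdiag N1 N2 N3.
have {}tr : al = 1 - be - ga by rewrite -tr; ring.
congr HCoord; rewrite ?tr; try ring; apply/joff_fixedP;
  rewrite !(cddiaD, f2, f3) -?Ha1; apply: cdform_inj => v;
  rewrite !(cdformDl, cdformZl) ?tr; ring.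
Qed.

(* Eliminates [x1] from the equations for the first and third off-diagonal
   entries; [cd_mul_sym] then leaves a single triple product. *)
Lemma rank1_elim (R : realType) n (al be ga y2 y3 : R[i])
    (a1 a2 a3 x1 x2 x3 : cdalg R n) :
  cd_alternative R n -> al != 0 -> rank1 (HCoord al be ga a1 a2 a3) ->
  joff be ga y2 y3 a1 a2 a3 x1 x2 x3 = x1 ->
  joff al be 0 y2 a3 a1 a2 x3 x1 x2 = x3 ->
  (al * (1 + al + ga)) *: x3 =
    (al * ((1 + al) * y2 + ga * (y2 + y3) + 2 * cdform a2 x2)) *: a3
    + cddia x2 \box (a2 \box a3).
Proof.
move=> alt al0 r1; have [N1 _ f3] := rank1_mul alt al0 r1.
case: r1 => N3 N2 Ha1 tr /joff_fixedP u1 /joff_fixedP u3.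
have {}tr : be = 1 - al - ga by rewrite -tr; ring.
have h1 : al *: cddia (a1 \box x2) = cddia x2 \box (a2 \box a3).
  by rewrite -cddiaZ -cdmulZl Ha1 cddiaM cddiaK.
(* The equation for [x1] multiplied by [a2] on the right; [2 - be - ga = 1 + al] by the trace. *)
have h2 : (1 + al) *: cddia (x1 \box a2) =
    ((y2 + y3) * ga + 2 * cdform a2 x2) *: a3 + (al * ga) *: x3
    - cddia x2 \box (a2 \box a3).
  have := congr1 (fun w => cddia (w \box a2)) u1.
  rewrite !(cdmulDl, cddiaD, cdmulZl, cddiaZ) f3 !(cddiaM (cddia _) a2) !cddiaK.
  rewrite alt N2 => e; apply: cdform_inj => v.
  have := congr1 (cdform^~ v) (cd_mul_sym a2 x2 a3 alt).
  have := congr1 (cdform^~ v) e.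
  rewrite !(cdformDl, cdformZl, cdformNl) tr => {}e s.
  by apply: (addr_lincomb (-1) e); apply: (addr_lincomb 1 s); ring.
apply: cdform_inj => v.
have := congr1 (cdform^~ v) u3; have := congr1 (cdform^~ v) h2.
have := congr1 (cdform^~ v) h1.
rewrite !(cddiaD, cdformDl, cdformZl, cdformNl) tr => {}h1 {}h2 {}u3.
apply: (addr_lincomb (- (al * (1 + al))) u3).
by apply: (addr_lincomb (1 + al) h1); apply: (addr_lincomb al h2); ring.
Qed.

(** The second equation, multiplied on the right by [a2 a3], contains [x3] times [N(a2 a3)] and the
    same triple product as the first. Eliminating that product relates [x3] to [a3] alone. *)
Lemma rank1_collinear (R : realType) n (al be ga A B : R[i])
    (a2 a3 x2 x3 : cdalg R n) :
  cd_alternative R n -> al != 0 -> 1 + al != 0 ->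
  cdform a3 a3 = al * be -> cdform a2 a2 = al * ga -> al + be + ga = 1 ->
  (al * (1 + al + ga)) *: x3 = (al * A) *: a3 + cddia x2 \box (a2 \box a3) ->
  (al * (1 + al + be)) *: cddia x2 =
    (al * B) *: cddia a2 + x3 \box (cddia a3 \box cddia a2) ->
  exists s, x3 = s *: a3.
Proof.
move=> alt al0 al1 N3 N2 tr v3 v2.
have {}tr : be = 1 - al - ga by rewrite -tr; ring.
have := congr1 (fun w => w \box (a2 \box a3)) v2.
rewrite cdmulDl !cdmulZl alt -cddiaM cd_mulVKr // cd_form_mul // N2 N3 => e.
have c2 : 2 != 0 :> R[i] by rewrite pnatr_eq0.
(* The determinant [al^2 ((1 + al + ga) (1 + al + be) - be ga)] of this elimination, simplified with
   [be + ga = 1 - al]. *)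
have c0 : 2 * (1 + al) * al ^+ 2 != 0 by rewrite !mulf_neq0 // expf_neq0.
exists ((2 * (1 + al) * al ^+ 2)^-1 * (al ^+ 2 * ((1 + al + be) * A + B * ga))).
apply: (scalerI c0); rewrite [RHS]scalerA (mulVKf c0).
apply: cdform_inj => v; move: (congr1 (cdform^~ v) v3) (congr1 (cdform^~ v) e).
rewrite !(cdformDl, cdformZl) tr => {}v3 {}e.
by apply: (addr_lincomb (al * (1 + al + (1 - al - ga))) v3);
  apply: (addr_lincomb 1 e); ring.
Qed.

(** As [be] and [ga] may vanish, only [s * be] and [t * ga] can be determined. The unknown [r]
    cancels between the equations, giving [y2 = 2 s be] and [y3 = 2 t ga]; subtracting [e3] from
    [e2] then finishes. *)
Lemma rank1_scalars (R : realType) (al be ga s t r y2 y3 : R[i]) :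
  al + be + ga = 1 ->
  t * ga + s * be = 0 ->
  (1 - be) * y2 = al * (s * be) + r * be * ga ->
  (1 - ga) * y3 = al * (t * ga) + r * be * ga ->
  be * (1 + ga) * s = be * (y2 + t * ga + r * ga) ->
  ga * (1 + be) * t = ga * (y3 + s * be + r * be) ->
  [/\ s * be = 0, t * ga = 0, y2 = 0 & y3 = 0].
Proof.
move=> tr e1 e2 e3 f3 f2.
have {}tr : al = 1 - be - ga by rewrite -tr; ring.
move: e2 e3; rewrite {}tr => e2 e3.
have y2E : y2 = 2 * (s * be).
  by apply: (addr_lincomb 1 e2); apply: (addr_lincomb (-1) f3);
    apply: (addr_lincomb (- be) e1); ring.
have y3E : y3 = 2 * (t * ga).
  by apply: (addr_lincomb 1 e3); apply: (addr_lincomb (-1) f2);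
    apply: (addr_lincomb (- ga) e1); ring.
have c2 : 2 != 0 :> R[i] by rewrite pnatr_eq0.
have sb : s * be = 0.
  apply: (mulfI c2); rewrite mulr0; rewrite y2E in e2; rewrite y3E in e3.
  apply: (addr_lincomb 1 e2); apply: (addr_lincomb (-1) e3);
    apply: (addr_lincomb (1 - ga + be) e1); ring.
have tg : t * ga = 0 by move: e1; rewrite sb addr0.
by rewrite y2E y3E sb tg mulr0.
Qed.

(** The last two hypotheses exclude isotropic [a2] and [a3]; real entries will provide them. *)
Lemma rank1_peirce0 (R : realType) n (al be ga y2 y3 : R[i])
    (a1 a2 a3 x1 x2 x3 : cdalg R n) (p := HCoord al be ga a1 a2 a3)
    (x := HCoord 0 y2 y3 x1 x2 x3) :
  cd_alternative R n -> al != 0 -> 1 + al != 0 -> rank1 p ->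
  (cdform a2 a2 = 0 -> a2 = 0) -> (cdform a3 a3 = 0 -> a3 = 0) ->
  jmul p x = x -> x = HCoord 0 0 0 0 0 0.
Proof.
move=> alt al0 al1 r1 nz2 nz3 [e1 e2 e3 u1 u2 u3].
have [N1 f2 f3] := rank1_mul alt al0 r1.
have v3 := rank1_elim alt al0 r1 u1 u3.
(* The flip exchanges the roles of [a2] and [a3], so the same elimination yields the companion
   equation for [cddia x2]. *)
have r1' : rank1 (hflip p).
  case: r1 => N3 N2 Ha1 tr; split; rewrite ?cdform_dia //.
    by rewrite -cddiaZ Ha1 cddiaM.
  by rewrite addrAC.
have v2 := rank1_elim alt al0 r1'
  (etrans (joff_flip _ _ _ _ _ _ _ _ _ _) (congr1 (@cddia R n) u1))
  (etrans (joff_flip _ _ _ _ _ _ _ _ _ _) (congr1 (@cddia R n) u2)).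
have v2' := v2; rewrite cddiaK in v2'.
case: r1 => N3 N2 Ha1 tr.
have [s x3E] := rank1_collinear alt al0 al1 N3 N2 tr v3 v2'.
have tr' : al + ga + be = 1 by rewrite addrAC.
have [t x2E'] : exists t, cddia x2 = t *: cddia a2.
  have N3' : cdform (cddia a3) (cddia a3) = al * be by rewrite cdform_dia.
  have N2' : cdform (cddia a2) (cddia a2) = al * ga by rewrite cdform_dia.
  apply: (rank1_collinear alt al0 al1 N2' N3' tr' v2); rewrite !cddiaK; exact: v3.
have {x2E'} x2E : x2 = t *: a2 by rewrite -[x2]cddiaK x2E' cddiaZ cddiaK.
(* Now both products in the equation for [x1] are multiples of [(a2 a3)^dia = al a1]. *)
have {v3 v2 v2' r1'} rE : (1 + al) *: x1 = (y2 + y3 + al * (s + t)) *: a1.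
  move/joff_fixedP: (u1); rewrite x2E x3E cdmulZl cdmulZr !(cddiaD, cddiaZ) -Ha1 => e.
  apply: cdform_inj => v; move: (congr1 (cdform^~ v) e).
  rewrite !(cdformDl, cdformZl) -tr => {}e.
  by apply: (addr_lincomb (-1) e); ring.
pose r := (1 + al)^-1 * (y2 + y3 + al * (s + t)).
have x1E : x1 = r *: a1.
  by apply: (scalerI al1); rewrite rE scalerA /r mulVKf.
have [] := @rank1_scalars R al be ga s t r y2 y3 tr.
- apply: (mulfI al0); move: e1; rewrite /jdiag x2E x3E !cdformZr N2 N3 => e1.
  by apply: (addr_lincomb 1 e1); ring.
- by move: e2; rewrite /jdiag x1E x3E !cdformZr N1 N3 => e2;
    apply: (addr_lincomb (-1) e2); ring.
- by move: e3; rewrite /jdiag x1E x2E !cdformZr N1 N2 => e3;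
    apply: (addr_lincomb (-1) e3); ring.
(* Pairing with [a3] gives a scalar equation with the factor [N(a3) = al be]; [al] is cancelled and
   [be] stays. *)
- move/joff_fixedP: u3; rewrite x1E x2E x3E cdmulZl cdmulZr !(cddiaD, cddiaZ) f3.
  move/(congr1 (cdform a3)); rewrite !(cdformDr, cdformZr) N3 -tr => e.
  by apply: (mulfI al0); apply: (addr_lincomb (-1) e); ring.
- move/joff_fixedP: u2; rewrite x1E x2E x3E cdmulZl cdmulZr !(cddiaD, cddiaZ) f2.
  move/(congr1 (cdform a2)); rewrite !(cdformDr, cdformZr) N2 -tr => e.
  by apply: (mulfI al0); apply: (addr_lincomb (-1) e); ring.
move=> sb tg y20 y30.
have x20 : x2 = 0.
  (* Either [t = 0], or [ga = 0] and then [N(a2) = 0] forces [a2 = 0]. *)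
  have /eqP := tg; rewrite x2E mulf_eq0 => /orP[/eqP->|/eqP g0]; first exact: scale0r.
  by rewrite nz2 ?scaler0 // N2 g0 mulr0.
have x30 : x3 = 0.
  have /eqP := sb; rewrite x3E mulf_eq0 => /orP[/eqP->|/eqP b0]; first exact: scale0r.
  by rewrite nz3 ?scaler0 // N3 b0 mulr0.
have x10 : x1 = 0.
  move/joff_fixedP: u1; rewrite x20 x30 y20 y30 cdmul0l cdmul0r !addr0 cddia0 scale0r !addr0.
  move/eqP; rewrite -subr_eq0 -scalerBl scaler_eq0 => /orP[/eqP h|/eqP //].
  (* A nonzero [x1] would need [be + ga = 2], that is [1 + al = 0]. *)
  case/eqP: al1; rewrite -oppr0 -h -tr; ring.
by rewrite /x x10 x20 x30 y20 y30.
Qed.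

Lemma rank1_peirce (R : realType) n (p x : hcoord R n) :
  cd_alternative R n -> hd1 p != 0 -> 1 + hd1 p != 0 -> rank1 p ->
  (cdform (hu2 p) (hu2 p) = 0 -> hu2 p = 0) ->
  (cdform (hu3 p) (hu3 p) = 0 -> hu3 p = 0) ->
  jmul p x = x -> x = hscale (hd1 x / hd1 p) p.
Proof.
move=> alt al0 al1 r1 nz2 nz3 xP; have pP := rank1_idem alt al0 r1.
have := jmul_linear (hd1 x / hd1 p) p x p; rewrite xP pP.
set c := hd1 x / hd1 p.
have cE : hd1 x - c * hd1 p = 0 by rewrite divfK // subrr.
case: p x @c cE {xP pP} al0 al1 r1 nz2 nz3 => [al be ga a1 a2 a3] [y1 y2 y3 x1 x2 x3].
rewrite [hd1 _]/= [hd1 (HCoord al _ _ _ _ _)]/=.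
move=> c cE al0 al1 r1 nz2 nz3.
rewrite /hsub /hscale /= cE => /(rank1_peirce0 alt al0 al1 r1 nz2 nz3) [].
move=> /subr0_eq-> /subr0_eq-> /subr0_eq-> /subr0_eq-> /subr0_eq->.
by rewrite (subr0_eq cE).
Qed.

(** * Complex conjugation as a ring automorphism *)

Lemma cdbarD (R : realType) n (x y : cdalg R n) :
  cdbar (x + y) = cdbar x + cdbar y.
Proof.
elim: n x y => [x y|n IH [x x'] [y y']] /=; first exact: rmorphD.
by congr pair; rewrite /= IH.
Qed.

Lemma cdbarZ (R : realType) n (c : R[i]) (x : cdalg R n) :
  cdbar (c *: x) = conjc c *: cdbar x.
Proof.
elim: n x => [x|n IH [x x']] /=; first exact: rmorphM.
by congr pair; rewrite /= IH.
Qed.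

Lemma cdbar_dia (R : realType) n (x : cdalg R n) :
  cdbar (cddia x) = cddia (cdbar x).
Proof. by elim: n x => //= n IH [x x'] /=; rewrite IH cdbarN. Qed.

Lemma cdbarM (R : realType) n (x y : cdalg R n) :
  cdbar (x \box y) = cdbar x \box cdbar y.
Proof.
elim: n x y => [x y|n IH [x x'] [y y']] /=; first exact: rmorphM.
by congr pair; rewrite /= cdbarD ?cdbarN !IH cdbar_dia.
Qed.

Lemma cdinj_inj (R : realType) n : injective (@cdinj R n).
Proof. by elim: n => // n IH c d [] /IH. Qed.

Lemma conjc_fixedP (R : realType) (c : R[i]) :
  conjc c = c <-> c = real_complex R (complex.Re c).
Proof.
case: c => x y; split=> [[] /eqP|[->]]; last by rewrite /= oppr0.
by rewrite eq_sym -subr_eq0 opprK -mulr2n mulrn_eq0 => /eqP->.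
Qed.

(** * Classification of minimal projections in coordinates *)

Definition hzero (R : realType) n : hcoord R n := HCoord 0 0 0 0 0 0.

(** Self-adjointness: since [cdstar] is [cdbar] after [cddia], a matrix in [C6] is fixed by [mxstar]
    exactly when its entries are fixed by [cdbar]. *)
Definition hreal (R : realType) n (p : hcoord R n) : Prop :=
  let: HCoord d1 d2 d3 u1 u2 u3 := p in
  [/\ conjc d1 = d1, conjc d2 = d2 & conjc d3 = d3] /\
  [/\ cdbar u1 = u1, cdbar u2 = u2 & cdbar u3 = u3].

(** Only one inclusion is demanded of the fixed points; multiples of an idempotent are fixed by
    [jmul_scale]. *)
Definition hminimal (R : realType) n (p : hcoord R n) : Prop :=
  [/\ hreal p, jmul p p = p,
      forall q, jmul p q = q -> exists c, q = hscale c p & p <> hzero R n].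

Lemma hrot3 (R : realType) n (p : hcoord R n) : hrot (hrot (hrot p)) = p.
Proof. by case: p. Qed.

(** The shift is an automorphism of order three, so applying it twice inverts it. *)
Lemma hminimal_rot (R : realType) n (p : hcoord R n) :
  hminimal (hrot p) <-> hminimal p.
Proof.
suff rot (q : hcoord R n) : hminimal q -> hminimal (hrot q).
  by split=> [/rot /rot|/rot //]; rewrite hrot3.
move=> [rq iq mq nq]; split.
- by case: q rq {iq mq nq} => ? ? ? ? ? ? [[? ? ?] [? ? ?]].
- by rewrite jmul_rot iq.
- move=> x xP; have [|c xE] := mq (hrot (hrot x)).
    by rewrite -[q in jmul q _]hrot3 !jmul_rot xP.
  by exists c; rewrite -[x]hrot3 xE.
- by move=> q0; apply: nq; rewrite -[q]hrot3 q0.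
Qed.

(** The third form of the theorem; [b] is the (1,3) entry, which the coordinates store as [cddia] of
    [hu2]. *)
Definition hpivot (R : realType) n (al : R) (a b : cdalg R n) : hcoord R n :=
  HCoord (real_complex R al) (real_complex R (al^-1 * cdnorm a ^+ 2))
    (real_complex R (al^-1 * cdnorm b ^+ 2))
    (real_complex R al^-1 *: (cddia a \box b)) (cddia b) a.

Lemma cdform_real_eq0 (R : realType) n (x : cdalg R n) :
  cdbar x = x -> cdform x x = 0 -> x = 0.
Proof. by move=> /cdform_real-> [/cdnorm2_eq0]. Qed.

Lemma hminimal_pivotP (R : realType) n (p : hcoord R n) :
  cd_alternative R n ->
  (hminimal p /\ hd1 p != 0) <->
  exists al a b, [/\ al != 0, cdbar a = a, cdbar b = b,
    al = al ^+ 2 + cdnorm a ^+ 2 + cdnorm b ^+ 2 & p = hpivot al a b].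
Proof.
move=> alt; split=> [[[rp ip mp _] d0]|[al [a [b [al0 ra rb alE ->]]]]].
  have [c] := mp _ (hcorner_fixed alt ip).
  case: p rp ip d0 {mp} => [d1 d2 d3 u1 u2 u3].
  move=> [[/conjc_fixedP r1 _ _] [_ b2 b3]] [i1 _ _ _ _ _] /= d0 [e1 e2 e3 f1 _ _].
  (* The first diagonal entry of [hcorner p = c p] reads [d1 ^+ 2 = c * d1]. *)
  have cE : c = d1 by apply: (mulIf d0); rewrite -e1.
  move: r1 d0 i1 e1 e2 e3 f1; rewrite {}cE; move: (complex.Re d1) => al ->.
  rewrite /jdiag !cdform_real // => d0 i1 e1 e2 e3 f1.
  have al0 : al != 0 by apply: contraNneq d0 => ->.
  have rdu : cdbar (cddia u2) = cddia u2 by rewrite cdbar_dia b2.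
  have n2 : cdnorm2 (cddia u2) = cdnorm2 u2.
    by have := cdform_real rdu; rewrite cdform_dia cdform_real // => -[->].
  exists al, u3, (cddia u2); split=> //.
    (* The norm equation is the (1,1) entry of [p o p = p]. *)
    apply: (fmorph_inj (real_complex R)).
    by rewrite !rmorphD rmorphXn !sqr_cdnorm n2 -[LHS]i1; ring.
  rewrite /hpivot cddiaK !sqr_cdnorm n2 !rmorphM /= e2 e3 -cddiaM f1.
  by rewrite scalerA !fmorphV !mulKf // mulVf // scale1r.
have alC : real_complex R al != 0 by rewrite fmorph_eq0.
(* The norm equation makes [al] a sum of squares; positivity later gives [1 + al != 0]. *)
have alp : 0 < al.
  rewrite lt0r al0 alE !addr_ge0 ?sqr_ge0 //.
have r1 : rank1 (hpivot al a b).
  rewrite /hpivot /rank1 !sqr_cdnorm !rmorphM /= fmorphV.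
  rewrite !mulVKf // cdform_dia !cdform_real //; split=> //.
    by rewrite scalerA divff // scale1r cddiaM cddiaK.
  (* Trace one, multiplied by [al], is the norm equation. *)
  apply: (mulfI alC); rewrite !mulrDr !mulVKf // mulr1 -rmorphM -!rmorphD.
  by rewrite -!sqr_cdnorm -expr2 [in RHS]alE.
have nz2 : cdform (cddia b) (cddia b) = 0 -> cddia b = 0.
  by rewrite cdform_dia => /(cdform_real_eq0 rb)->; rewrite cddia0.
have nz3 := cdform_real_eq0 ra.
have al1 : 1 + real_complex R al != 0.
  by rewrite -[1]/(real_complex R 1) -rmorphD fmorph_eq0 gt_eqF // addr_gt0.
split=> //; split.
- rewrite /hreal /hpivot; split; split; rewrite ?conjc_real //.
    by rewrite cdbarZ conjc_real cdbarM cdbar_dia ra rb.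
  by rewrite cdbar_dia rb.
- exact: rank1_idem.
- by move=> q /(rank1_peirce (p := hpivot al a b) alt alC al1 r1 nz2 nz3) ->; eexists.
- by move=> [al0']; rewrite al0' eqxx in al0.
Qed.

(** The (1,1) entry of [p o p = p] becomes a vanishing sum of squared norms. *)
Lemma hminimal_d1_eq0 (R : realType) n (p : hcoord R n) :
  hminimal p -> hd1 p = 0 -> hu2 p = 0 /\ hu3 p = 0.
Proof.
move=> [rp ip _ _] d0; case: p rp ip d0 => [d1 d2 d3 u1 u2 u3].
move=> [_ [_ r2 r3]] [] /= i1 _ _ _ _ _ d0.
move: i1; rewrite /jdiag d0 mul0r add0r !cdform_real // -rmorphD => -[] /eqP.
by rewrite paddr_eq0 ?cdnorm2_ge0 // => /andP[/eqP/cdnorm2_eq0-> /eqP/cdnorm2_eq0->].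
Qed.

Lemma hminimalP (R : realType) n (p : hcoord R n) :
  cd_alternative R n ->
  hminimal p <->
  [\/ p = HCoord 0 0 1 0 0 0,
      exists al a, [/\ al != 0, cdbar a = a, al = al ^+ 2 + cdnorm a ^+ 2 &
        p = HCoord 0 (real_complex R al) (real_complex R (al^-1 * cdnorm a ^+ 2)) a 0 0]
    | exists al a b, [/\ al != 0, cdbar a = a, cdbar b = b,
        al = al ^+ 2 + cdnorm a ^+ 2 + cdnorm b ^+ 2 & p = hpivot al a b]].
Proof.
move=> alt.
have bar0 : cdbar (0 : cdalg R n) = 0.
  by rewrite -(scale0r 0) cdbarZ conjc0 !scale0r.
have norm0 : cdnorm (0 : cdalg R n) ^+ 2 = 0.
  by have [] := cdform_real bar0; rewrite cdform0l sqr_cdnorm => -[].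
have pivot0 al a : hpivot al a (0 : cdalg R n) =
    HCoord (real_complex R al) (real_complex R (al^-1 * cdnorm a ^+ 2)) 0 0 0 a.
  by rewrite /hpivot norm0 mulr0 cdmul0r scaler0 cddia0.
split=> [mp|].
  have [d1|d1] := eqVneq (hd1 p) 0; last first.
    by apply: Or33; apply/hminimal_pivotP.
  have [u2 u3] := hminimal_d1_eq0 mp d1.
  have mp' := (hminimal_rot p).2 mp.
  have [d2|d2] := eqVneq (hd2 p) 0; last first.
    have /(hminimal_pivotP _ alt)[al [a [b [al0 ra rb alE pE]]]] := conj mp' d2.
    apply: Or32; exists al, a.
    (* The shift moves [hu3 p], already zero, to the place of [cddia b]. *)
    have b0 : b = 0 by rewrite -[b]cddiaK -[cddia b]/(hu2 (hpivot al a b)) -pE /= u3 cddia0.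
    move: alE pE; rewrite b0 norm0 addr0 pivot0 => alE pE; split=> //.
    by rewrite -[p]hrot3 pE.
  have [_ u1] := hminimal_d1_eq0 mp' d2.
  apply: Or31; case: p {mp'} mp d1 d2 u1 u2 u3 => [d1 d2 d3 u1 u2 u3] /= mp.
  move=> d10 d20 u10 u20 u30; move: mp; rewrite {}d10 {}d20 {}u10 {}u20 {}u30.
  move=> [_ [_ _ + _ _ _] _ np]; rewrite /jdiag !cdform0l !addr0 => /eqP.
  (* Only [d3 = d3 * d3] remains, and [d3 = 0] would make [p] zero. *)
  rewrite -subr_eq0 -{3}[d3]mulr1 -mulrBr mulf_eq0 subr_eq0 => /orP[]/eqP d3E.
    by case: np; rewrite d3E.
  by rewrite d3E.
case=> [->|[al [a [al0 ra alE ->]]]|/hminimal_pivotP[]//].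
  (* Two shifts bring the entry [1] to the pivot, where [al = 1] and [a = b = 0]. *)
  apply: (hminimal_rot _).1; apply: (hminimal_rot _).1.
  apply: (proj1 ((hminimal_pivotP _ alt).2 _)); exists 1, 0, 0.
  by rewrite pivot0 norm0 mulr0 expr1n !addr0 oner_neq0.
apply: (hminimal_rot _).1; apply: (proj1 ((hminimal_pivotP _ alt).2 _)); exists al, a, 0.
by rewrite pivot0 norm0 addr0.
Qed.

(** * From matrices in [C6] to coordinates *)

Local Notation i0 := (@Ordinal 3 0 isT).
Local Notation i1 := (@Ordinal 3 1 isT).
Local Notation i2 := (@Ordinal 3 2 isT).

Lemma ord3P (P : 'I_3 -> Prop) : P i0 -> P i1 -> P i2 -> forall i, P i.
Proof.
move=> P0 P1 P2 [[|[|[|//]]] i3].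
- by rewrite (_ : Ordinal i3 = i0) //; apply: val_inj.
- by rewrite (_ : Ordinal i3 = i1) //; apply: val_inj.
- by rewrite (_ : Ordinal i3 = i2) //; apply: val_inj.
Qed.

Lemma big_ord3 (V : nmodType) (F : 'I_3 -> V) :
  \sum_(k < 3) F k = F i0 + (F i1 + F i2).
Proof.
rewrite !big_ord_recl big_ord0 addr0; congr (_ + (_ + _)); congr F; exact: val_inj.
Qed.

Lemma mx33E (T : Type) (a00 a01 a02 a10 a11 a12 a20 a21 a22 : T) :
  let M := mx33 a00 a01 a02 a10 a11 a12 a20 a21 a22 in
  ((M i0 i0 = a00) * (M i0 i1 = a01) * (M i0 i2 = a02) *
   (M i1 i0 = a10) * (M i1 i1 = a11) * (M i1 i2 = a12) *
   (M i2 i0 = a20) * (M i2 i1 = a21) * (M i2 i2 = a22))%type.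
Proof. by do !split; rewrite mxE. Qed.

Definition hmx (R : realType) (p : hcoord R 3) : 'M[octonion R]_3 :=
  mx33 (cdinj 3 (hd1 p)) (hu3 p) (cddia (hu2 p))
       (cddia (hu3 p)) (cdinj 3 (hd2 p)) (hu1 p)
       (hu2 p) (cddia (hu1 p)) (cdinj 3 (hd3 p)).

Lemma hmxE (R : realType) (p : hcoord R 3) :
  [/\ hmx p i0 i0 = cdinj 3 (hd1 p), hmx p i1 i1 = cdinj 3 (hd2 p) &
      hmx p i2 i2 = cdinj 3 (hd3 p)] /\
  [/\ hmx p i1 i2 = hu1 p, hmx p i2 i0 = hu2 p & hmx p i0 i1 = hu3 p].
Proof. by rewrite /hmx !mx33E. Qed.

Lemma hmx_inj (R : realType) : injective (@hmx R).
Proof.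
move=> p q e.
have E i j : hmx p i j = hmx q i j by rewrite e.
have := (E i0 i0, E i1 i1, E i2 i2, E i1 i2, E i2 i0, E i0 i1).
rewrite /hmx !mx33E => -[[[[[]]]]].
move=> /cdinj_inj + /cdinj_inj + /cdinj_inj.
case: p q {e E} => [? ? ? ? ? ?] [? ? ? ? ? ?].
by rewrite /hd1 /hd2 /hd3 /hu1 /hu2 /hu3 => -> -> -> -> -> ->.
Qed.

Lemma hmx_C6 (R : realType) (p : hcoord R 3) : C6 (hmx p).
Proof.
apply/matrixP; apply: ord3P; apply: ord3P;
  by rewrite mxE /hmx !mx33E ?cddia_inj ?cddiaK.
Qed.

Lemma C6_entry (R : realType) (x : 'M[octonion R]_3) i j :
  C6 x -> cddia (x j i) = x i j.
Proof. by move=> xC; rewrite -[in RHS]xC mxE. Qed.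

Lemma C6_ext (R : realType) (x y : 'M[octonion R]_3) : C6 x -> C6 y ->
  x i0 i0 = y i0 i0 -> x i1 i1 = y i1 i1 -> x i2 i2 = y i2 i2 ->
  x i1 i2 = y i1 i2 -> x i2 i0 = y i2 i0 -> x i0 i1 = y i0 i1 -> x = y.
Proof.
move=> xC yC e00 e11 e22 e12 e20 e01.
by apply/matrixP; apply: ord3P; apply: ord3P => //;
  rewrite -(C6_entry _ _ xC) -(C6_entry _ _ yC); congr cddia.
Qed.

Lemma C6_hmx (R : realType) (x : 'M[octonion R]_3) :
  C6 x -> exists p, x = hmx p.
Proof.
move=> xC.
have [d1 e1] := cddia_fixed (C6_entry i0 i0 xC).
have [d2 e2] := cddia_fixed (C6_entry i1 i1 xC).
have [d3 e3] := cddia_fixed (C6_entry i2 i2 xC).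
pose p := HCoord d1 d2 d3 (x i1 i2) (x i2 i0) (x i0 i1); exists p.
have [[h1 h2 h3] [h4 h5 h6]] := hmxE p.
exact: (C6_ext xC (hmx_C6 p) (etrans e1 (esym h1)) (etrans e2 (esym h2))
  (etrans e3 (esym h3)) (esym h4) (esym h5) (esym h6)).
Qed.

Lemma jordan_C6 (R : realType) (x y : 'M[octonion R]_3) :
  C6 x -> C6 y -> C6 (jordan x y).
Proof.
move=> xC yC; apply/matrixP => i j; rewrite !mxE cddiaZ cddiaD addrC.
congr (_ *: (_ + _)); rewrite !big_ord3 !cddiaD !cddiaM;
  by rewrite !(C6_entry _ _ xC) !(C6_entry _ _ yC).
Qed.

(** Symmetrization pairs each product with its conjugate, so every pair is a scalar by
    [cdmul_dia_sym]. *)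
Lemma jdiag_entry (R : realType) n (d e : R[i]) (a x b y : cdalg R n) :
  2^-1 *: ((cdinj n d \box cdinj n e + (b \box cddia y + cddia a \box x)) +
           (cdinj n e \box cdinj n d + (y \box cddia b + cddia x \box a))) =
  cdinj n (jdiag d e a x b y).
Proof.
rewrite addrACA [X in _ + X]addrACA cdmul_dia_sym.
have := cdmul_dia_sym (cddia a) (cddia x); rewrite !cddiaK cdform_dia => ->.
rewrite !cdmul_injl -!cdinjZ -!cdinjD -cdinjZ; congr cdinj.
have c2 : 2 != 0 :> R[i] by rewrite pnatr_eq0.
by apply: (mulfI c2); rewrite mulVKf // /jdiag; ring.
Qed.

Lemma joff_entry (R : realType) n (d2 d3 e2 e3 : R[i])
    (a1 a2 a3 x1 x2 x3 : cdalg R n) :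
  2^-1 *: ((cddia a3 \box cddia x2 + (cdinj n d2 \box x1 + a1 \box cdinj n e3)) +
           (cddia x3 \box cddia a2 + (cdinj n e2 \box a1 + x1 \box cdinj n d3))) =
  joff d2 d3 e2 e3 a1 a2 a3 x1 x2 x3.
Proof.
rewrite /joff -!cddiaM !cdmul_injl !cdmul_injr cddiaD; congr (_ *: _).
by apply: cdform_inj => v; rewrite !(cdformDl, cdformZl); ring.
Qed.

Lemma addr3_rot (V : zmodType) (x y z : V) : x + (y + z) = y + (z + x).
Proof. by rewrite addrC addrA. Qed.

(** The six independent entries as [big_ord3] expands them; they are cyclic shifts of [jdiag_entry]
    and [joff_entry] up to the order of the three summands. *)
Lemma jmul_entries (R : realType) n (d1 d2 d3 e1 e2 e3 : R[i])
    (a1 a2 a3 x1 x2 x3 : cdalg R n) :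
  [/\ 2^-1 *: (cdinj n d1 \box cdinj n e1 + (a3 \box cddia x3 + cddia a2 \box x2) +
        (cdinj n e1 \box cdinj n d1 + (x3 \box cddia a3 + cddia x2 \box a2))) =
      cdinj n (jdiag d1 e1 a2 x2 a3 x3),
      2^-1 *: (cddia a3 \box x3 + (cdinj n d2 \box cdinj n e2 + a1 \box cddia x1) +
        (cddia x3 \box a3 + (cdinj n e2 \box cdinj n d2 + x1 \box cddia a1))) =
      cdinj n (jdiag d2 e2 a3 x3 a1 x1) &
      2^-1 *: (a2 \box cddia x2 + (cddia a1 \box x1 + cdinj n d3 \box cdinj n e3) +
        (x2 \box cddia a2 + (cddia x1 \box a1 + cdinj n e3 \box cdinj n d3))) =
      cdinj n (jdiag d3 e3 a1 x1 a2 x2)] /\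
  [/\ 2^-1 *: (cddia a3 \box cddia x2 + (cdinj n d2 \box x1 + a1 \box cdinj n e3) +
        (cddia x3 \box cddia a2 + (cdinj n e2 \box a1 + x1 \box cdinj n d3))) =
      joff d2 d3 e2 e3 a1 a2 a3 x1 x2 x3,
      2^-1 *: (a2 \box cdinj n e1 + (cddia a1 \box cddia x3 + cdinj n d3 \box x2) +
        (x2 \box cdinj n d1 + (cddia x1 \box cddia a3 + cdinj n e3 \box a2))) =
      joff d3 d1 e3 e1 a2 a3 a1 x2 x3 x1 &
      2^-1 *: (cdinj n d1 \box x3 + (a3 \box cdinj n e2 + cddia a2 \box cddia x1) +
        (cdinj n e1 \box a3 + (x3 \box cdinj n d2 + cddia x2 \box cddia a1))) =
      joff d1 d2 e1 e2 a3 a1 a2 x3 x1 x2].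
Proof.
split; split; rewrite -?jdiag_entry -?joff_entry //; congr (_ *: _).
- by rewrite (addr3_rot (cddia a3 \box _)) (addr3_rot (cddia x3 \box _)).
- by rewrite -(addr3_rot (cdinj n d3 \box _)) -(addr3_rot (cdinj n e3 \box _)).
- by rewrite (addr3_rot (a2 \box _)) (addr3_rot (x2 \box _)).
- by rewrite -(addr3_rot (cddia a2 \box _)) -(addr3_rot (cddia x2 \box _)).
Qed.

Lemma jordan_hmx (R : realType) (p q : hcoord R 3) :
  jordan (hmx p) (hmx q) = hmx (jmul p q).
Proof.
apply: C6_ext; first by apply: jordan_C6; exact: hmx_C6.
- exact: hmx_C6.
all: rewrite [LHS]mxE [X in _ *: X]mxE ![mxbox _ _ _ _]mxE !big_ord3 /hmx !mx33E.
all: case: p q => [d1 d2 d3 a1 a2 a3] [e1 e2 e3 x1 x2 x3].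
all: rewrite /jmul /hd1 /hd2 /hd3 /hu1 /hu2 /hu3.
all: have [[h1 h2 h3] [h4 h5 h6]] :=
  jmul_entries d1 d2 d3 e1 e2 e3 a1 a2 a3 x1 x2 x3.
- exact: h1.
- exact: h2.
- exact: h3.
- exact: h4.
- exact: h5.
- exact: h6.
Qed.

Lemma mxscale_hmx (R : realType) (c : R[i]) (p : hcoord R 3) :
  mxscale c (hmx p) = hmx (hscale c p).
Proof.
apply/matrixP; apply: ord3P; apply: ord3P;
  rewrite mxE /hmx !mx33E /hscale /hd1 /hd2 /hd3 /hu1 /hu2 /hu3 ?cdinjZ ?cddiaZ;
  exact: erefl.
Qed.

Lemma mxstar_hmx (R : realType) (p : hcoord R 3) :
  mxstar (hmx p) = hmx p <-> hreal p.
Proof.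
have starE i j : mxstar (hmx p) i j = cdbar (hmx p i j).
  by rewrite mxE cdstarE (C6_entry _ _ (hmx_C6 p)).
split=> [e|].
  have E i j : cdbar (hmx p i j) = hmx p i j by rewrite -starE e.
  move: (E i0 i0) (E i1 i1) (E i2 i2) (E i1 i2) (E i2 i0) (E i0 i1).
  rewrite /hmx !mx33E !cdbar_inj.
  case: p {e E starE} => d1 d2 d3 u1 u2 u3; rewrite /hd1 /hd2 /hd3 /hu1 /hu2 /hu3.
  by move=> /cdinj_inj ? /cdinj_inj ? /cdinj_inj ? ? ? ?.
move=> rp; apply/matrixP => i j; rewrite starE; move: i j.
case: p rp {starE} => d1 d2 d3 u1 u2 u3 [[r1 r2 r3] [b1 b2 b3]].
apply: ord3P; apply: ord3P;
  rewrite /hmx !mx33E /hd1 /hd2 /hd3 /hu1 /hu2 /hu3 ?cdbar_inj ?cdbar_dia;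
  by congr (cdinj 3 _) || congr cddia || assumption.
Qed.

(** * Minimal projections in matrix form *)

Lemma jordanC (R : realType) (x y : 'M[octonion R]_3) : jordan x y = jordan y x.
Proof. by rewrite /jordan addrC. Qed.

(** With [p] self-adjoint, the last two terms of the triple product cancel by commutativity, and
    [p o p = p] simplifies the first. *)
Lemma triple_projection (R : realType) (p x : 'M[octonion R]_3) :
  projection p -> triple p p x = jordan p x.
Proof.
case=> _ ps pp.
rewrite /triple ps.
rewrite -[jordan p p]pp.
rewrite (jordanC x p).
exact: addrK.
Qed.

Lemma projection_hmx (R : realType) (p : hcoord R 3) :
  projection (hmx p) <-> hreal p /\ jmul p p = p.
Proof.
split=> [[_ /mxstar_hmx rp]|[rp ip]].
  by rewrite jordan_hmx => /hmx_inj.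
by split; [exact: hmx_C6|exact/mxstar_hmx|rewrite jordan_hmx ip].
Qed.

Lemma minimal_projection_hmx (R : realType) (p : hcoord R 3) :
  minimal_projection (hmx p) <-> hminimal p.
Proof.
have z0 : hmx (hzero R 3) = 0.
  apply/matrixP; apply: ord3P; apply: ord3P; rewrite /hmx mx33E mxE ?cddia0 //.
have s0 (q : hcoord R 3) : hscale 0 q = hzero R 3.
  by rewrite /hscale !mul0r !scale0r.
have s1 (q : hcoord R 3) : hscale 1 q = q.
  by case: q => *; rewrite /hscale /= !mul1r !scale1r.
split=> [[pp pm p0]|[rp ip mp p0]].
  have [rp ip] := (projection_hmx p).1 pp; split=> // [q qP|pz].
    have : [set x | C6 x /\ triple (hmx p) (hmx p) x = x]%classic (hmx q).
      by split; [exact: hmx_C6|rewrite triple_projection // jordan_hmx qP].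
    by rewrite pm => -[c _]; rewrite mxscale_hmx => /hmx_inj <-; exists c.
  apply: p0; rewrite pz; apply/seteqP; split=> [x [c _ <-]|x ->].
    by rewrite mxscale_hmx /= -z0 /hscale /= !mulr0 !scaler0.
  by exists 0 => //; rewrite mxscale_hmx s0 z0.
have pp : projection (hmx p) by apply/projection_hmx.
split=> //.
  apply/seteqP; split=> x [] /=.
    rewrite triple_projection // => /C6_hmx[q ->].
    by rewrite jordan_hmx => /hmx_inj /mp[c ->]; exists c; rewrite // mxscale_hmx.
  move=> c _ <-; rewrite mxscale_hmx; split; first exact: hmx_C6.
  by rewrite triple_projection // jordan_hmx jmul_scale ip.
move=> sp; have : complex_span (hmx p) (hmx p).
  by exists 1; rewrite // mxscale_hmx s1.
by rewrite sp /= -z0 => /hmx_inj.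
Qed.

Theorem theorem8p1 (R : realType) (p : 'M[octonion R]_3) :
  minimal_projection p <->
  [\/ p = mx33 0 0 0
               0 0 0
               0 0 (octonion_of_real 1),
      exists (alpha : R) (a : octonion R),
        [/\ alpha != 0, octR a, alpha = alpha ^+ 2 + cdnorm a ^+ 2 &
         p = mx33
           0 0 0
           0 (octonion_of_real alpha) a
           0 (cddia a) (octonion_of_real (alpha^-1 * cdnorm a ^+ 2))]
    | exists (alpha : R) (a b : octonion R),
        [/\ alpha != 0, octR a, octR b,
            alpha = alpha ^+ 2 + cdnorm a ^+ 2 + cdnorm b ^+ 2 &
         p = mx33
           (octonion_of_real alpha) a b
           (cddia a) (octonion_of_real (alpha^-1 * cdnorm a ^+ 2))
             (real_complex R alpha^-1 *: (cddia a \box b))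
           (cddia b) (real_complex R alpha^-1 *: (cddia b \box a))
             (octonion_of_real (alpha^-1 * cdnorm b ^+ 2))]].
Proof.
have inj0 : cdinj 3 (0 : R[i]) = 0 by apply/eqP; rewrite cdinj_eq0.
have E1 : mx33 0 0 0 0 0 0 0 0 (octonion_of_real 1) =
    hmx (HCoord 0 0 1 0 0 0 : hcoord R 3).
  by rewrite /hmx /hd1 /hd2 /hd3 /hu1 /hu2 /hu3 inj0 !cddia0.
have E2 al a : mx33 0 0 0 0 (octonion_of_real al) a
    0 (cddia a) (octonion_of_real (al^-1 * cdnorm a ^+ 2)) =
    hmx (HCoord 0 (real_complex R al) (real_complex R (al^-1 * cdnorm a ^+ 2)) a 0 0).
  by rewrite /hmx /hd1 /hd2 /hd3 /hu1 /hu2 /hu3 inj0 !cddia0.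
have E3 al a b : mx33 (octonion_of_real al) a b
    (cddia a) (octonion_of_real (al^-1 * cdnorm a ^+ 2))
    (real_complex R al^-1 *: (cddia a \box b))
    (cddia b) (real_complex R al^-1 *: (cddia b \box a))
    (octonion_of_real (al^-1 * cdnorm b ^+ 2)) = hmx (hpivot al a b).
  rewrite /hmx /hpivot /hd1 /hd2 /hd3 /hu1 /hu2 /hu3.
  (* The (3,2) entry is the conjugate of the (2,3) entry. *)
  by rewrite cddiaZ cddiaM !cddiaK.
have alt := @oct_alternative R.
split=> [mp|].
  have [[pC _ _] _ _] := mp; have [h pE] := C6_hmx pC; subst p.
  have [->|[al [a [? ? ? ->]]]|[al [a [b [? ? ? ? ->]]]]] :=
    (hminimalP h alt).1 ((minimal_projection_hmx h).1 mp).
  - by apply: Or31; rewrite E1.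
  - by apply: Or32; exists al, a; rewrite E2.
  - by apply: Or33; exists al, a, b; rewrite E3.
case=> [->|[al [a [? ? ? ->]]]|[al [a [b [? ? ? ? ->]]]]].
- by rewrite E1; apply/minimal_projection_hmx/(hminimalP _ alt)/Or31.
- rewrite E2; apply/minimal_projection_hmx/(hminimalP _ alt)/Or32.
  by exists al, a.
- rewrite E3; apply/minimal_projection_hmx/(hminimalP _ alt)/Or33.
  by exists al, a, b.
Qed.
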